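(* Let $\mathbb{K}$ be an algebraically closed field of characteristic zero and let $k$ be a nonnegative integer. There exists a form $F\in\mathbb{K}[x,y,z]$ of degree $2k+2$ with $\operatorname{rk} F>k^2+3k+2$.
   Context: A form is a homogeneous polynomial. The (Waring) rank $\operatorname{rk} F$ of a form $F\in\mathbb{K}[x,y,z]$ of degree $d$ is the least number $r$ such that $F$ can be written as a sum $F=\ell_1^d+\cdots+\ell_r^d$ of $d$-th powers of linear forms $\ell_1,\ldots,\ell_r\in\mathbb{K}[x,y,z]$ (homogeneous polynomials of degree one). *)

(* Defs.v *)
From mathcomp Require Import all_boot all_order all_algebra.
From mathcomp Require Import mpoly.

Set Implicit Arguments.
Unset Strict Implicit.
Unset Printing Implicit Defensive.

Import GRing.Theory.
Local Open Scope ring_scope.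

Definition has_waring_decomp (K : fieldType) (n d : nat)
    (F : {mpoly K[n]}) (r : nat) : Prop :=
  exists l : 'I_r -> {mpoly K[n]},
    (forall i, l i \is 1.-homog) /\ F = \sum_(i < r) l i ^+ d.

(* The degree d is explicit because the zero polynomial is homogeneous of every
   degree.  The relation includes the existence of a decomposition of length r,
   so it never holds vacuously. *)
Definition is_waring_rank (K : fieldType) (n d : nat)
    (F : {mpoly K[n]}) (r : nat) : Prop :=
  has_waring_decomp d F r /\
  forall s : nat, has_waring_decomp d F s -> (r <= s)%N.

(* Main.v *)
Require Import Defs.
From mathcomp Require Import all_boot all_order all_algebra.
From mathcomp Require Import cyclic separable cyclotomic.
From mathcomp Require Import mpoly zify ring.

(** For p < q, the form x y^p z^q + y^(p+q+1) has rank exactly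
    (p + 1)(q + 1) + 1; the theorem is the case p = k, q = k + 1.

    Upper bound: averaging e (u + e v)^(a+b) over the (b+1)-st roots of unity e
    isolates u^a v^b as soon as a <= b. Applied to x y^p, and then to the
    powers so obtained times z^q, this decomposes the monomial.

    Lower bound: the coefficients of a sum of d-th powers of the linear forms
    a_t x + b_t y + c_t z are, up to nonzero factors, the moments
    sum_t a_t^(d-i-j) b_t^i c_t^j. A Hankel matrix of these moments factors
    through the set of those t with a_t != 0, while for the above form it is
    triangular with nonzero diagonal, of size (p + 1)(q + 1) in general and one
    more if every a_t is nonzero. *)

Set Implicit Arguments.
Unset Strict Implicit.
Unset Printing Implicit Defensive.

Import GRing.Theory.
Local Open Scope ring_scope.

Lemma row_free_graded_trig (K : fieldType) n (deg : 'I_n -> nat)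
    (M : 'M[K]_n) :
  (forall i, M i i != 0) ->
  (forall i j, i != j -> (deg i <= deg j)%N -> M i j = 0) ->
  row_free M.
Proof.
move=> diagM trigM; rewrite -kermx_eq0.
apply/rowV0P => c /sub_kermxP cM0; apply/eqP/contraT => /rV0Pn[i0 ci0].
case: (@arg_maxnP _ i0 (fun i => c 0 i != 0) deg ci0) => j cj jmax.
have /eqP := congr1 (fun r : 'rV_n => r 0 j) cM0.
rewrite !mxE (bigD1 j) //= big1 ?addr0 => [|i ij].
  by rewrite mulf_eq0 (negPf cj) (negPf (diagM j)).
have [->|ci] := eqVneq (c 0 i) 0; first by rewrite mul0r.
by rewrite trigM ?mulr0 //; apply: jmax.
Qed.

Lemma leq_card_trig_pairing (K : fieldType) (T I : finType) (J : {set I})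
    (deg : T -> nat) (X Y : T -> I -> K) :
  (forall u, \sum_(i in J) X u i * Y u i != 0) ->
  (forall u v, u != v -> (deg u <= deg v)%N ->
     \sum_(i in J) X u i * Y v i = 0) ->
  (#|T| <= #|J|)%N.
Proof.
move=> diagXY trigXY.
pose A := \matrix_(s < #|T|, j < #|J|) X (enum_val s) (enum_val j).
pose B := \matrix_(j < #|J|, t < #|T|) Y (enum_val t) (enum_val j).
have ABE s t :
    (A *m B) s t = \sum_(i in J) X (enum_val s) i * Y (enum_val t) i.
  by rewrite mxE [RHS]big_enum_val; apply: eq_bigr => j _; rewrite !mxE.
have /eqP <- : row_free (A *m B).
  apply: (@row_free_graded_trig _ _ (fun s => deg (enum_val s))) => [s|s t st].
    by rewrite ABE.
  by rewrite ABE => /trigXY; apply; rewrite (inj_eq enum_val_inj).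
exact/(leq_trans (mxrankM_maxl A B))/rank_leq_col.
Qed.

Section AffineMoments.

Variables (K : fieldType) (I : finType) (a b c : I -> K).

Definition moment d i j :=
  \sum_t a t ^+ (d - (i + j)) * b t ^+ i * c t ^+ j.

Definition affine_points := [set t | a t != 0].

Definition affine_monomial i j t := (b t / a t) ^+ i * (c t / a t) ^+ j.

Lemma affine_hankel d i j i' j' :
  (i + i' + (j + j') <= d)%N ->
  (i + i' + (j + j') < d)%N || (affine_points == setT) ->
  \sum_(t in affine_points)
    affine_monomial i j t * (a t ^+ d * affine_monomial i' j' t) =
  moment d (i + i') (j + j').
Proof.
move=> led ltd; rewrite /moment [RHS](bigID (mem affine_points)) /=.
rewrite [X in _ + X]big1 ?addr0 => [|t].
  apply: eq_bigr => t; rewrite inE => at_neq0.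
  rewrite -{1}(subnK led) /affine_monomial !exprD !exprMn !exprVn.
  have atX_neq0 n : a t ^+ n != 0 by rewrite expf_neq0.
  by field; rewrite !atX_neq0.
case/orP: ltd => [ltd|/eqP ->]; last by rewrite inE.
rewrite inE negbK => /eqP ->.
by rewrite expr0n subn_eq0 leqNgt ltd !mul0r.
Qed.

Variables p q : nat.
Let d := (p + q).+1.
Let block := ('I_p.+1 * 'I_q.+1)%type.
Let block_deg (u : block) := (u.1 + u.2)%N.
(* The columns are the complements y^(p - i) z^(q - j) of the rows y^i z^j: a row
   and its own column meet in the moment (p, q). *)
Let block_row (u : block) := affine_monomial u.1 u.2.
Let block_col (v : block) t :=
  a t ^+ d * affine_monomial (p - v.1) (q - v.2) t.

(* This is what a power sum decomposition of x y^p z^q + y^d provides. *)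
Hypothesis moment_neq0 : forall i j, (i + j <= d)%N ->
  (moment d i j != 0) = ((i, j) \in [:: (p, q); (d, 0%N)]).

Let moment_eq0 i j :
  (i + j <= d)%N -> (i, j) \notin [:: (p, q); (d, 0%N)] -> moment d i j = 0.
Proof. by move=> ijd; rewrite -moment_neq0 // negbK => /eqP. Qed.

Let block_pairing u v : (block_deg u <= block_deg v)%N ->
  (\sum_(t in affine_points) block_row u t * block_col v t != 0) = (u == v).
Proof.
case: u v => [u1 u2] [v1 v2]; rewrite /block_deg /= => uv.
have := ltn_ord u1; have := ltn_ord u2; have := ltn_ord v1.
have := ltn_ord v2 => *.
rewrite affine_hankel /=; [|rewrite /d; lia|apply/orP; left; rewrite /d; lia].
by rewrite moment_neq0 ?inE ?xpair_eqE -?val_eqE /= /d; lia.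
Qed.

Let block_trig u v : u != v -> (block_deg u <= block_deg v)%N ->
  \sum_(t in affine_points) block_row u t * block_col v t = 0.
Proof. by move=> /negPf uv /block_pairing; rewrite uv => /negPn/eqP. Qed.

Lemma leq_card_affine_points : (p.+1 * q.+1 <= #|affine_points|)%N.
Proof.
have <- : #|{: block}| = (p.+1 * q.+1)%N by rewrite card_prod !card_ord.
apply: leq_card_trig_pairing block_trig => u.
by rewrite block_pairing.
Qed.

(* The additional row y^(d/2) and column y^(d - d/2) meet in the moment (d, 0);
   as p < d/2, all the other moments they bring in that have to vanish do so. *)
Lemma ltn_card_affine_points :
  (p < q)%N -> affine_points = setT -> (p.+1 * q.+1 < #|affine_points|)%N.
Proof.
move=> pq affT; pose h := d./2.
have hp : (p < h)%N by rewrite /h /d; lia.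
have hd : (h <= d)%N by rewrite /h; lia.
have <- : #|{: option block}| = (p.+1 * q.+1).+1.
  by rewrite card_option card_prod !card_ord.
pose row u := if u is Some u then block_row u else affine_monomial h 0.
pose col v := if v is Some v then block_col v
  else fun t => a t ^+ d * affine_monomial (d - h) 0 t.
pose deg u := if u is Some u then block_deg u else h.
apply: (@leq_card_trig_pairing _ _ _ _ deg row col).
  case=> [u|]; first by rewrite block_pairing.
  rewrite affine_hankel ?affT ?eqxx ?orbT ?addn0 ?subnKC //.
  by rewrite moment_neq0 ?addn0 // !inE eqxx orbT.
case=> [[u1 u2]|] [[v1 v2]|] //.
- by rewrite (inj_eq Some_inj); apply: block_trig.
- have := ltn_ord u1; have := ltn_ord u2 => ltu2 ltu1 _.
  rewrite /deg /block_deg /= => uh.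
  rewrite affine_hankel ?affT ?eqxx ?orbT //=; last by lia.
  by apply: moment_eq0; rewrite ?inE ?xpair_eqE /d; lia.
have := ltn_ord v1; have := ltn_ord v2 => ltv2 ltv1 _.
rewrite /deg /block_deg /= => hv.
rewrite affine_hankel ?affT ?eqxx ?orbT //=; last by rewrite /d; lia.
by apply: moment_eq0; rewrite ?inE ?xpair_eqE /d; lia.
Qed.

Lemma ltn_card_points : (p < q)%N -> (p.+1 * q.+1 < #|I|)%N.
Proof.
move=> pq; have [affT|affNT] := eqVneq affine_points setT.
  by rewrite -cardsT -affT ltn_card_affine_points.
by rewrite -cardsT (leq_ltn_trans leq_card_affine_points) //
  proper_card // properT.
Qed.

End AffineMoments.

Lemma mderivXn (R : comNzRingType) n (i : 'I_n) (f : {mpoly R[n]}) m :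
  (f ^+ m.+1)^`M(i) = (f^`M(i) * f ^+ m) *+ m.+1.
Proof.
elim: m => [|m IHm]; first by rewrite mulr1.
by rewrite exprS mderivM IHm mulrnAr mulrCA -exprS -mulrS.
Qed.

Definition linear_form (R : nzRingType) n (a : 'I_n -> R) : {mpoly R[n]} :=
  \sum_i a i *: 'X_i.

Lemma mderiv_linear_form (R : nzRingType) n (a : 'I_n -> R) i :
  (linear_form a)^`M(i) = (a i)%:MP.
Proof.
rewrite /linear_form raddf_sum (bigD1 i) //= big1 ?addr0 => [|j ji].
  rewrite mderivZ mderivX mnm1E eqxx scale1r -[X in (X - _)%MM]add0m addmK.
  by rewrite mpolyX0 alg_mpolyC.
by rewrite mderivZ mderivX mnm1E (negPf ji) scale0r scaler0.
Qed.

Lemma dhomog1_linear_form (R : nzRingType) n (l : {mpoly R[n]}) :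
  l \is 1.-homog -> l = linear_form (fun i => l@_U_(i)).
Proof.
move=> hl; apply/mpolyP => m; rewrite /linear_form (raddf_sum (mcoeff m)) /=.
under eq_bigr do rewrite mcoeffZ mcoeffX.
have [/mdeg1P[i /eqP ->]|mN1] := boolP (mdeg m == 1%N).
  rewrite (bigD1 i) //= eqxx mulr1 big1 ?addr0 // => j ji.
  by rewrite eq_mnm1 (negPf ji) mulr0.
rewrite (dhomog_nemf_coeff hl mN1) big1 // => i _.
have [Um|_] := eqVneq U_(i)%MM m; last by rewrite mulr0.
by rewrite -Um mdeg1 in mN1.
Qed.

Lemma mcoeff_linear_formX (R : comNzRingType) n (a : 'I_n -> R) m :
  (linear_form a ^+ mdeg m)@_m *+ (\prod_i (m i)`!) =
  'X_[m].@[a] *+ (mdeg m)`!.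
Proof.
move dE: (mdeg m) => d; elim: d => [|d IHd] in m dE *.
  move/eqP: dE; rewrite mdeg_eq0 => /eqP ->.
  by rewrite mpolyX0 meval1 expr0 mcoeff1 eqxx big1 // => i _; rewrite mnmE.
have [i mi_gt0] : exists i, (0 < m i)%N.
  apply/existsP; apply: contraT; rewrite negb_exists => /forallP m0.
  by move: dE; rewrite mdegE big1 // => i _; apply/eqP; rewrite eqn0Ngt.
have mE : m = (m - U_(i) + U_(i))%MM by rewrite submK // lep1mP -lt0n.
set m' := (m - U_(i))%MM in mE; rewrite {mi_gt0}mE in dE *.
have dE' : mdeg m' = d by move: dE; rewrite mdegD mdeg1 addn1 => -[].
have -> : (\prod_j ((m' + U_(i))%MM j)`! = (m' i).+1 * \prod_j (m' j)`!)%N.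
  rewrite (bigD1 i) //= [in RHS](bigD1 i) //= mnmDE mnm1E eqxx addn1 mulnA.
  congr (_ * _)%N; apply: eq_bigr => j ji.
  by rewrite mnmDE mnm1E eq_sym (negPf ji) addn0.
rewrite mulrnA -mcoeff_deriv mderivXn mderiv_linear_form.
rewrite mcoeffMn mcoeffCM mulrnAC -mulrnAr (IHd _ dE').
by rewrite mpolyXD rmorphM /= mevalXU factS mulnC mulrnA mulrnAr mulrC.
Qed.

Lemma power_sum_moment_neq0 (K : fieldType) n (I : finType)
    (a : I -> 'I_n -> K) m :
  [pchar K] =i pred0 ->
  (\sum_t 'X_[m].@[a t] != 0) =
  (m \in msupp (\sum_t linear_form (a t) ^+ mdeg m)).
Proof.
move=> /pcharf0P charK0; rewrite mcoeff_msupp (raddf_sum (mcoeff m)) /=.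
have mulrn_pchar0_eq0 (x : K) r : (0 < r)%N -> (x *+ r == 0) = (x == 0).
  by rewrite -mulr_natr mulf_eq0 charK0 lt0n => /negPf ->; rewrite orbF.
rewrite -(mulrn_pchar0_eq0 _ (mdeg m)`!) ?fact_gt0 // -sumrMnl.
rewrite -[in RHS](mulrn_pchar0_eq0 _ (\prod_i (m i)`!)%N) -?sumrMnl; last first.
  by apply: prodn_gt0 => i; apply: fact_gt0.
by congr (_ != _); apply: eq_bigr => t _; rewrite mcoeff_linear_formX.
Qed.

Lemma closed_prim_root_exists (K : closedFieldType) n :
  n%:R != 0 :> K -> exists z : K, n.-primitive_root z.
Proof.
move=> nK; have n_gt0 : (0 < n)%N by case: n nK => //; rewrite eqxx.
have [zs] := closed_field_poly_normal ('X^n - 1 : {poly K}).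
rewrite (monicP (monicXnsubC 1 n_gt0)) scale1r => zsE.
suff /hasP[z _ zn] : has n.-primitive_root zs by exists z.
apply: has_prim_root => //.
- apply/allP => z zzs; rewrite unity_rootE -subr_eq0.
  by have := root_prod_XsubC zs z; rewrite -zsE zzs /root !hornerE.
- by rewrite -separable_prod_XsubC -zsE; apply: separable_Xn_sub_1.
by have := size_prod_XsubC zs id; rewrite -zsE size_XnsubC // => -[->].
Qed.

Lemma sum_prim_rootX (R : idomainType) n (z : R) m : n.-primitive_root z ->
  \sum_(i < n) (z ^+ i) ^+ m = if (n %| m)%N then n%:R else 0.
Proof.
move=> zn; under eq_bigr do rewrite exprAC.
rewrite (prim_order_dvd zn); have [->|zm] := eqVneq (z ^+ m) 1.
  by under eq_bigr do rewrite expr1n; rewrite sumr_const card_ord.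
apply: (mulfI (x := z ^+ m - 1)); first by rewrite subr_eq0.
by rewrite -subrX1 exprAC (prim_expr_order zn) expr1n subrr mulr0.
Qed.

Lemma prim_root_binomial_filter (K : fieldType) (A : comAlgType K) (u v : A)
    (e : K) a b :
  b.+1.-primitive_root e -> (a <= b)%N ->
  \sum_(i < b.+1) e ^+ i *: (u + e ^+ i *: v) ^+ (a + b) =
  (b.+1 * 'C(a + b, b))%:R *: (u ^+ a * v ^+ b).
Proof.
move=> be ab.
transitivity (\sum_(j < (a + b).+1)
    ((\sum_(i < b.+1) (e ^+ i) ^+ j.+1) * 'C(a + b, j)%:R) *:
      (u ^+ (a + b - j) * v ^+ j)).
  under eq_bigr do rewrite exprDn scaler_sumr.
  rewrite exchange_big; apply: eq_bigr => j _ /=.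
  rewrite mulr_suml scaler_suml; apply: eq_bigr => i _.
  by rewrite exprZn -scalerAr -scaler_nat !scalerA exprS mulrAC.
have ltb : (b < (a + b).+1)%N by rewrite ltnS leq_addl.
under eq_bigr do rewrite (sum_prim_rootX _ be).
rewrite (bigD1 (Ordinal ltb)) //= dvdnn big1 ?addr0 => [|j].
  by rewrite addnK natrM.
rewrite -val_eqE /= => jb; rewrite ifN ?mul0r ?scale0r //.
apply: contra jb => /dvdnP[[|[|r]]] //; first by rewrite mul1n => -[->].
by have := ltn_ord j; rewrite !mulSn; lia.
Qed.

Lemma has_waring_decompD (K : fieldType) n d (F G : {mpoly K[n]}) r s :
  has_waring_decomp d F r -> has_waring_decomp d G s ->
  has_waring_decomp d (F + G) (r + s).
Proof.
move=> [l [hl ->]] [l' [hl' ->]].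
exists (fun i => match split i with inl j => l j | inr j => l' j end).
split=> [i|]; first by case: (split i).
rewrite big_split_ord /=; congr (_ + _); apply: eq_bigr => i _.
  by rewrite (unsplitK (inl i)).
by rewrite (unsplitK (inr i)).
Qed.

Lemma has_waring_decomp_sum (K : fieldType) n d r s (F : 'I_r -> {mpoly K[n]}) :
  (forall i, has_waring_decomp d (F i) s) ->
  has_waring_decomp d (\sum_i F i) (r * s).
Proof.
elim: r F => [|r IHr] F decF.
  by rewrite big_ord0; exists (fun=> 0); split=> [[]|] //; rewrite big_ord0.
by rewrite big_ord_recl; apply: has_waring_decompD => //; apply: IHr.
Qed.

Lemma has_waring_decompX (K : fieldType) n d (l : {mpoly K[n]}) :
  l \is 1.-homog -> has_waring_decomp d (l ^+ d) 1.
Proof. by move=> hl; exists (fun=> l); rewrite big_ord1. Qed.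

Lemma has_waring_decompZ (K : closedFieldType) n d (F : {mpoly K[n]}) r w :
  (0 < d)%N -> has_waring_decomp d F r -> has_waring_decomp d (w *: F) r.
Proof.
move=> d_gt0 [l [hl ->]].
have /closed_rootP[x] : size ('X^d - w%:P) != 1%N by rewrite size_XnsubC; lia.
rewrite /root !hornerE subr_eq0 => /eqP xd.
exists (fun i => x *: l i); split=> [i|]; first exact/dhomogZ/hl.
by rewrite scaler_sumr; apply: eq_bigr => i _; rewrite exprZn xd.
Qed.

Lemma has_waring_decompMX (K : closedFieldType) n (F v : {mpoly K[n]}) a b r :
  [pchar K] =i pred0 -> (0 < b -> a <= b)%N ->
  v \is 1.-homog -> has_waring_decomp a F r ->
  has_waring_decomp (a + b) (F * v ^+ b) (r * b.+1).
Proof.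
move=> /pcharf0P charK0 ab hv [l [hl FE]].
have [->|b_gt0] := posnP b; first by rewrite addn0 mulr1 muln1; exists l.
have ab_gt0 : (0 < a + b)%N by rewrite addn_gt0 b_gt0 orbT.
have [e be] : exists e : K, b.+1.-primitive_root e.
  by apply: closed_prim_root_exists; rewrite charK0.
have N_neq0 : (b.+1 * 'C(a + b, b))%:R != 0 :> K.
  by rewrite charK0 -lt0n muln_gt0 bin_gt0 leq_addl.
rewrite FE mulr_suml; apply: has_waring_decomp_sum => i.
rewrite -[l i ^+ a * _](scalerK N_neq0).
rewrite -(prim_root_binomial_filter _ _ be (ab b_gt0)).
apply: has_waring_decompZ => //.
rewrite -[X in has_waring_decomp _ _ X]muln1.
apply: has_waring_decomp_sum => j.
by apply/has_waring_decompZ/has_waring_decompX; rewrite ?dhomogD ?dhomogZ.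
Qed.

Definition mnm3 p q r : 'X_{1..3} :=
  (U_(0%R) *+ p + U_(1%R) *+ q + U_(2%R) *+ r)%MM.

Lemma eq_mnm3 p q r p' q' r' :
  (mnm3 p q r == mnm3 p' q' r') = [&& p == p', q == q' & r == r'].
Proof.
apply/eqP/and3P => [/mnmP eqm|[/eqP-> /eqP-> /eqP->]] //.
move: (eqm 0%R) (eqm 1%R) (eqm 2%R).
by rewrite !mnmE /= !mulmnE !mnm1E /= => *; split; lia.
Qed.

Lemma mdeg_mnm3 p q r : mdeg (mnm3 p q r) = (p + q + r)%N.
Proof. by rewrite !mdegD !mdegMn !mdeg1 !mul1n. Qed.

Lemma mpolyX_mnm3 (R : nzRingType) p q r :
  'X_[mnm3 p q r] = 'X_0 ^+ p * 'X_1 ^+ q * 'X_2 ^+ r :> {mpoly R[3]}.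
Proof. by rewrite !mpolyXD -!mpolyXn. Qed.

Definition monomial_plus_power (K : fieldType) p q : {mpoly K[3]} :=
  'X_[mnm3 1 p q] + 'X_[mnm3 0 (p + q).+1 0].

Lemma monomial_plus_power_homog (K : fieldType) p q :
  monomial_plus_power K p q \is (p + q).+1.-homog.
Proof. by rewrite dhomogD // dhomogX /= mdeg_mnm3 // addn0. Qed.

Lemma msupp_monomial_plus_power (K : fieldType) p q m :
  (m \in msupp (monomial_plus_power K p q)) =
  (m == mnm3 1 p q) || (m == mnm3 0 (p + q).+1 0).
Proof.
rewrite mcoeff_msupp mcoeffD !mcoeffX ![_ == m]eq_sym.
have [->|_] := eqVneq m (mnm3 1 p q); first by rewrite eq_mnm3 addr0 oner_eq0.
by rewrite add0r; case: (m == _); rewrite ?oner_eq0 ?eqxx.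
Qed.

Lemma ltn_waring_decomp_monomial_plus_power (K : fieldType) p q s :
  [pchar K] =i pred0 -> (p < q)%N ->
  has_waring_decomp (p + q).+1 (monomial_plus_power K p q) s ->
  (p.+1 * q.+1 < s)%N.
Proof.
move=> charK0 pq [l [hl FE]]; rewrite -[s]card_ord.
pose v t i := (l t)@_U_(i).
have {}FE : monomial_plus_power K p q = \sum_t linear_form (v t) ^+ (p + q).+1.
  by rewrite FE; apply: eq_bigr => t _; rewrite -dhomog1_linear_form.
apply: (@ltn_card_points _ _ (v^~ 0) (v^~ 1) (v^~ 2)) => // i j ijd.
have mE : mdeg (mnm3 ((p + q).+1 - (i + j)) i j) = (p + q).+1.
  by rewrite mdeg_mnm3; lia.
have := power_sum_moment_neq0 v (mnm3 ((p + q).+1 - (i + j)) i j) charK0.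
rewrite mE -FE msupp_monomial_plus_power !eq_mnm3 !inE !xpair_eqE.
under eq_bigr do rewrite mpolyX_mnm3 !rmorphM !rmorphXn /= !mevalXU.
by move=> ->; lia.
Qed.

Lemma has_waring_decomp_monomial_plus_power (K : closedFieldType) p q :
  [pchar K] =i pred0 -> (p < q)%N ->
  has_waring_decomp (p + q).+1 (monomial_plus_power K p q) (p.+1 * q.+1).+1.
Proof.
move=> charK0 pq; have homX i : 'X_i \is [in K[3], 1.-homog].
  by rewrite dhomogX /= mdeg1.
rewrite /monomial_plus_power !mpolyX_mnm3 !mul1r mulr1.
rewrite -[X in has_waring_decomp _ _ X]addn1.
apply: has_waring_decompD; last exact: has_waring_decompX.
apply: (@has_waring_decompMX _ _ _ _ p.+1) => //.
rewrite -[X in has_waring_decomp _ _ X]mul1n.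
by apply: (@has_waring_decompMX _ _ _ _ 1) => //; apply: has_waring_decompX.
Qed.

Lemma waring_rank_monomial_plus_power (K : closedFieldType) p q :
  [pchar K] =i pred0 -> (p < q)%N ->
  is_waring_rank (p + q).+1 (monomial_plus_power K p q) (p.+1 * q.+1).+1.
Proof.
move=> charK0 pq; split; first exact: has_waring_decomp_monomial_plus_power.
by move=> s; apply: ltn_waring_decomp_monomial_plus_power.
Qed.

Theorem proposition2 (K : closedFieldType) (charK0 : [pchar K] =i pred0)
    (k : nat) :
  exists (F : {mpoly K[3]}) (r : nat),
    F \is (2 * k + 2).-homog /\
    is_waring_rank (2 * k + 2) F r /\
    (k ^ 2 + 3 * k + 2 < r)%N.
Proof.
have -> : (2 * k + 2 = (k + k.+1).+1)%N by lia.
exists (monomial_plus_power K k k.+1), (k.+1 * k.+2).+1.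
split; first exact: monomial_plus_power_homog.
split; first exact: waring_rank_monomial_plus_power.
by rewrite -mulnn; lia.
Qed.
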